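(* For any $m\in\mathbb{N}$, $$\sum_{1\le N_1<\cdots<N_m}\frac{1}{N_m^2\cdots N_1^2}=(-1)^m\sum_{\substack{(y_1,\ldots,y_m)\\ \sum i y_i=m}}\prod_{i=1}^{m}\frac{(-1)^{y_i}}{y_i!\,i^{y_i}}\big(\zeta(2i)\big)^{y_i}=\frac{\pi^{2m}}{(2m+1)!}$$ and $$\sum_{\substack{(y_1,\ldots,y_m)\\ \sum i y_i=m}}\prod_{i=1}^{m}\frac{1}{y_i!}\left(\frac{B_{2i}}{(2i)\,(2i)!}\right)^{y_i}=\frac{1}{2^{2m}(2m+1)!},$$ where the sums over $(y_1,\ldots,y_m)$ run over all partitions of $m$.
   Context: $\mathbb{N}=\{0,1,2,\ldots\}$. $\zeta$ is the Riemann zeta function and $B_j$ are the Bernoulli numbers, $\frac{t}{e^t-1}=\sum_{j\ge0}B_j\frac{t^j}{j!}$. A partition of $m$ is represented by the tuple $(y_1,\ldots,y_m)$ of non-negative integers with $\sum_{i=1}^m i\,y_i=m$. For $m=0$ there is exactly one partition, the empty one. Empty products equal $1$. The series on the left ranges over all strictly increasing $m$-tuples of positive integers and equals $1$ when $m=0$. *)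

(* Defs.v *)
From HB Require Import structures.
From mathcomp Require Import all_boot all_order all_algebra.
From mathcomp Require Import all_classical all_reals all_analysis.
From mathcomp Require Import ring lra.

Set Implicit Arguments.
Unset Strict Implicit.
Unset Printing Implicit Defensive.

Import Order.TTheory GRing.Theory Num.Theory.
Import numFieldNormedType.Exports.

Local Open Scope classical_set_scope.
Local Open Scope ring_scope.

(* Dirichlet series of the Riemann zeta function: this is zeta(s) for real
   s > 1; for s <= 1 the series diverges and the value is meaningless. *)
Definition zeta (R : realType) (s : R) : R :=
  limn (series (fun n : nat => (n.+1%:R `^ s)^-1)).

Definition bernoulli_gf (R : realType) (B : nat -> R) : Prop :=
  \forall t \near (0 : R)^',
    series (fun j : nat => B j * (t ^+ j / j`!%:R)) @ \oo --> t / (expR t - 1).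

(* The sequence B_j with t / (e^t - 1) = \sum_j B_j t^j / j!. The default
   value of xget is never used, see [bernoulliP] below. *)
Definition bernoulli (R : realType) : nat -> R :=
  xget (fun=> 0) [set B | @bernoulli_gf R B].

(* Partitions of m in multiplicity form: the entry y i is the number of parts
   equal to i.+1. A tuple of natural numbers with \sum_i i.+1 * y_i = m has all
   its entries at most m, so that they can be taken in 'I_m.+1. *)
Definition partitions (m : nat) : {set {ffun 'I_m -> 'I_m.+1}} :=
  [set y : {ffun 'I_m -> 'I_m.+1} | (\sum_(i < m) i.+1 * y i)%N == m].

(* Existence of the Bernoulli numbers: gf_coef is the power series inverse of
   (e^t - 1) / t = \sum_k t^k / (k + 1)!, with |gf_coef n| <= 1. *)
Section BernoulliExists.
Variable R : realType.

Fixpoint gf_coefs (n : nat) : seq R :=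
  if n is m.+1 then
    rcons (gf_coefs m)
      (- \sum_(j < n) (gf_coefs m)`_j / ((n - j).+1)`!%:R)
  else [:: 1].

Definition gf_coef (n : nat) : R := (gf_coefs n)`_n.

Let size_gf_coefs n : size (gf_coefs n) = n.+1.
Proof. by elim: n => //= n IH; rewrite size_rcons IH. Qed.

Let nth_gf_coefs n j : (j <= n)%N -> (gf_coefs n)`_j = gf_coef j.
Proof.
elim: n => [|n IH] jn; first by move: jn; rewrite leqn0 => /eqP->.
move: jn; rewrite leq_eqVlt => /orP[/eqP->//|jn].
by rewrite /= nth_rcons size_gf_coefs jn IH.
Qed.

Let gf_coefS n :
  gf_coef n.+1 = - \sum_(j < n.+1) gf_coef j / ((n.+1 - j).+1)`!%:R.
Proof.
rewrite /gf_coef [in LHS]/= nth_rcons size_gf_coefs ltnn eqxx.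
by congr (- _); apply: eq_bigr => j _; rewrite (@nth_gf_coefs n) ?leq_ord.
Qed.

Let gf_coef_conv n :
  \sum_(j < n.+1) gf_coef j / ((n - j).+1)`!%:R = (n == 0%N)%:R.
Proof.
case: n => [|n]; first by rewrite big_ord1 /gf_coef /= invr1 mulr1.
by rewrite big_ord_recr /= subnn invr1 mulr1 [X in _ + X]gf_coefS subrr.
Qed.

Let fact_exp2 n : (2 ^ n <= n.+1`!)%N.
Proof. by elim: n => // n IH; rewrite factS expnS leq_mul. Qed.

Let sum_pow2 n : \sum_(j < n.+1) ((2:R) ^+ (n.+1 - j))^-1 = 1 - (2 ^+ n.+1)^-1.
Proof.
elim: n => [|n IH]; first by rewrite big_ord1 subn0 expr1; lra.
rewrite big_ord_recl /= subn0.
under eq_bigr do rewrite /bump leq0n add1n subSS.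
rewrite IH [in X in X + _]exprS [in RHS]exprS invfM.
set x := (_ ^+ _)^-1; lra.
Qed.

Let gf_coef_le1 n : `|gf_coef n| <= 1.
Proof.
elim/ltn_ind: n => -[_|n IH]; first by rewrite /gf_coef /= normr1.
rewrite gf_coefS normrN (le_trans (ler_norm_sum _ _ _)) //.
apply: (@le_trans _ _ (\sum_(j < n.+1) ((2:R) ^+ (n.+1 - j))^-1)).
  apply: ler_sum => j _; rewrite normrM -[leRHS]mul1r ler_pM //.
    exact: IH.
  rewrite ger0_norm ?invr_ge0 ?ler0n // lef_pV2 ?posrE ?exprn_gt0 ?ltr0n ?fact_gt0 //.
  by rewrite -natrX ler_nat fact_exp2.
by rewrite sum_pow2 lerBlDr lerDl invr_ge0 exprn_ge0.
Qed.

Let c n : R := (n.+1`!%:R)^-1.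

Let c_le1 n : `|c n| <= 1.
Proof.
by rewrite ger0_norm ?invr_ge0 // invf_le1 ?ltr0n ?fact_gt0 // ler1n fact_gt0.
Qed.

Let P n (t : R) := \sum_(i < n) gf_coef i * t ^+ i.
Let E n (t : R) := \sum_(i < n) c i * t ^+ i.

Let PE n t : `|t| <= 1 ->
  `|P n.+1 t * E n.+1 t - 1| <= (n.+1 * (n.+1 + n.+1))%:R * `|t| ^+ n.+1.
Proof.
move=> t1; set N := n.+1.
pose p := \poly_(i < N) gf_coef i; pose q := \poly_(i < N) c i.
have -> : P N t = p.[t] by rewrite horner_poly.
have -> : E N t = q.[t] by rewrite horner_poly.
rewrite -hornerM (@horner_coef_wide _ (N + N)); last first.
  apply: leq_trans (size_polyMleq _ _) _.
  by rewrite (leq_trans (leq_pred _)) // leq_add // size_poly.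
have pqlow i : (i < N)%N -> (p * q)`_i = (i == 0%N)%:R.
  move=> iN; rewrite coefM -gf_coef_conv; apply: eq_bigr => j _.
  rewrite !coef_poly (leq_ltn_trans (leq_subr _ _) iN).
  by rewrite (leq_ltn_trans _ iN) // -ltnS.
have pqle i : `|(p * q)`_i| <= i.+1%:R.
  rewrite coefM (le_trans (ler_norm_sum _ _ _)) //.
  rewrite -[in leRHS](card_ord i.+1) -sumr_const ler_sum // => j _.
  rewrite !coef_poly normrM -[leRHS]mulr1 ler_pM //.
    by case: ifP => _; rewrite ?normr0.
  by case: ifP => _; rewrite ?normr0.
rewrite big_split_ord /= big_ord_recl /= pqlow // expr0 mulr1.
rewrite big1 ?addr0 => [|i _]; last first.
  by rewrite pqlow ?mul0r // /bump leq0n add1n ltnS.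
rewrite addrAC subrr add0r (le_trans (ler_norm_sum _ _ _)) //.
rewrite natrM -mulrA -[X in _ <= X%:R * _](card_ord N) mulr_natl -sumr_const.
apply: ler_sum => i _; rewrite normrM ler_pM // ?normrX.
  by rewrite (le_trans (pqle _)) // ler_nat -addnS leq_add2l.
by rewrite exprD ler_piMr ?exprn_ge0 // exprn_ile1.
Qed.

Let sq_exp4 n : (n * (n + n) <= 2 * 4 ^ n)%N.
Proof.
have h : (n <= 2 ^ n)%N by rewrite ltnW // ltn_expl.
by rewrite addnn -mul2n mulnCA leq_mul2l /= (expnMn 2 2) leq_mul.
Qed.

Let PE_cvg t : `|t| <= 8^-1 -> P n t * E n t @[n --> \oo] --> (1 : R).
Proof.
move=> t8; have t1 : `|t| <= 1 by lra.
have z2 : `|2^-1 : R| < 1 by rewrite ger0_norm; lra.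
rewrite -(cvg_shiftS (fun n => P n t * E n t)).
apply/cvgrPdist_le => e e0.
have /cvgrPdist_le/(_ e e0) := @cvg_geometric R 1 2^-1 z2.
apply: filterS => n; rewrite /geometric /= sub0r normrN mul1r => ne.
rewrite distrC (le_trans (PE n t1)) // (le_trans _ ne) //.
rewrite [leRHS]ger0_norm ?exprn_ge0 ?invr_ge0 //.
apply: (@le_trans _ _ ((2 * 4 ^ n.+1)%:R * (8^-1) ^+ n.+1)).
  by rewrite ler_pM // ?ler_nat ?sq_exp4 // ?exprn_ge0 // lerXn2r ?nnegrE // invr_ge0.
rewrite natrM natrX -mulrA -exprMn.
have -> : (4 * 8^-1 : R) = 2^-1 by lra.
rewrite exprS; set x := _ ^+ _; lra.
Qed.

Let E_cvg t : t != 0 -> E n t @[n --> \oo] --> (expR t - 1) / t.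
Proof.
move=> t0.
have -> : E ^~ t = fun n => (series (exp_coeff t) n.+1 - 1) / t.
  apply/funext => n; rewrite /E /series /= big_mkord big_ord_recl /=.
  rewrite /exp_coeff /= expr0 divr1 addrAC subrr add0r mulr_suml.
  apply: eq_bigr => i _; rewrite /bump leq0n add1n exprS /c.
  by rewrite mulrC -mulrA [RHS]mulrC !mulrA mulVf // mul1r.
apply: cvgMr_tmp; apply: cvgB; last exact: cvg_cst.
rewrite (cvg_shiftS (series (exp_coeff t))).
exact: is_cvg_series_exp_coeff.
Qed.

Let gf_coefP : bernoulli_gf (fun n => n`!%:R * gf_coef n).
Proof.
have e8 : (0 : R) < 8^-1 by lra.
rewrite /bernoulli_gf.
apply: filterS2 (dnbhs0_le e8) (nbhs_dnbhs_neq (0 : R)) => t t8 t0.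
have -> : series (fun j => j`!%:R * gf_coef j * (t ^+ j / j`!%:R)) = P ^~ t.
  apply/funext => n; rewrite /series /= big_mkord; apply: eq_bigr => i _.
  by rewrite mulrAC mulrCA divff ?mulr1 1?mulrC // pnatr_eq0 -lt0n fact_gt0.
have L0 : (expR t - 1) / t != 0 by rewrite mulf_neq0 ?invr_eq0 // subr_eq0 -expR0 (inj_eq (@expR_inj R)).
have Ecv := E_cvg t0.
have := cvgM (PE_cvg t8) (cvgV L0 Ecv).
rewrite mul1r invf_div => PEcv; apply: cvg_trans (PEcv _ _); apply: near_eq_cvg.
have En0 : \forall n \near \oo, E n t != 0 by exact: cvgr_neq0 Ecv L0.
by apply: filterS En0 => n En0 /=; rewrite mulfK.
Qed.

Lemma bernoulliP : bernoulli_gf (bernoulli R).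
Proof. by apply: xgetPex; exists (fun n => n`!%:R * gf_coef n). Qed.

End BernoulliExists.

(* Main.v *)
Require Import Defs.
From HB Require Import structures.
From mathcomp Require Import all_boot all_order all_algebra.
From mathcomp Require Import all_classical all_reals all_analysis.
From mathcomp Require Import ring lra zify.

(** The three sums are values of one formal identity. If H = exp(\sum_i d_i X^i)
then collecting the monomials of the exponential series of each d_i X^i gives
  [X^m] H = \sum_(partitions y of m) \prod_i d_i^(y_i) / y_i!,
and X H' = (\sum_i i d_i X^i) H is a recursion which determines the
coefficients of H ([exp_coef_unique]). A sequence is thus identified with a sum
over partitions as soon as it satisfies the recursion.

Zeta values. For P_n = \prod_(k < n) (1 - x_k X) the recursion is Newton's
identity, so that the coefficients of P_n are partition sums in the power sums
of the x_k ([coef_prod_power_sums]); up to sign they are also the elementary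
symmetric functions of the x_k. With x_k = 1/(k+1)^2 the power sums tend to
zeta(2i), and the elementary symmetric functions tend to the sum over strictly
increasing tuples ([esum_increasing]): this is the first equality.

Powers of pi. With N = 2n+1, de Moivre's formula writes sin(N t) as
cos^N t tan t Q(tan^2 t), with Q = \sum_j (-1)^j C(N, 2j+1) X^j. The n roots
of Q are the tan^2(k pi/N), so that
  Q = N \prod_(1 <= k <= n) (1 - cot^2(k pi/N) X)
([tan_odd_factorization]). From 1/t^2 - 1 <= cot^2 t <= 1/t^2 on ]0, pi/2[, the
power sums of the (pi/N)^2 cot^2(k pi/N) have the same limits zeta(2i) as those
of the 1/k^2. The partition sums being continuous in the power sums, the limit of
the coefficient (-1)^m (pi/N)^(2m) C(N, 2m+1)/N, which is
(-1)^m pi^(2m)/(2m+1)!, is the partition sum of the zeta values ([zeta_coefE]).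

Bernoulli numbers. With h_m = 1/(2^(2m) (2m+1)!) the coefficient of t^(2m) in
sinh(t/2)/(t/2), the equality
  t/(e^t - 1) * 2 sinh(t/2)/t = e^(-t/2)
gives, on comparing the coefficients of t^(2m),
\sum_(0 <= i <= m) B_(2i)/(2i)! h_(m-i) = (2m+1) h_m. As B_0 = 1, the other terms
add up to 2m h_m, which is twice the recursion for d_i = B_(2i)/(2i (2i)!).
The comparison of coefficients is justified for power series that converge
near 0 by [power_series_near0_mul] and [power_series_near0_inj]. *)

Set Implicit Arguments.
Unset Strict Implicit.
Unset Printing Implicit Defensive.

Import Order.TTheory GRing.Theory Num.Theory.
Import numFieldNormedType.Exports.
Local Open Scope classical_set_scope.
Local Open Scope ring_scope.

(** * Partition sums as coefficients of an exponential *)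

Lemma mul_monomials (F : numFieldType) (a b : F) i j :
  (a *: 'X^i) * (b *: 'X^j) = (a * b) *: 'X^(i + j) :> {poly F}.
Proof. by rewrite -!mul_polyC polyCM exprD; ring. Qed.

Section Exponential.
Variables (F : numFieldType) (d : nat -> F).

(** The coefficient of X^m in exp(\sum_i d_i X^(i+1)): indices are shifted by
    one as in [partitions]. *)
Definition exp_coef (m : nat) : F :=
  \sum_(y in partitions m) \prod_(i < m) (d i ^+ y i / (y i)`!%:R).

(** The truncation at the K-th term of the series exp(d_i X^(i+1)). *)
Definition exp_factor (K i : nat) : {poly F} :=
  \sum_(k < K.+1) (d i ^+ k / k`!%:R) *: 'X^(i.+1 * k).

(** Distributing the product of the truncated series yields one monomial for each
    function y, of degree \sum_i i.+1 * y i. *)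
Lemma exp_coefE m : exp_coef m = (\prod_(i < m) exp_factor m i)`_m.
Proof.
rewrite /exp_factor bigA_distr_bigA /= coef_sum.
rewrite /exp_coef big_mkcond /=; apply: eq_bigr => y _.
rewrite [in RHS]scaler_prod coefZ inE prodrXr coefXn eq_sym.
by case: eqP => _; rewrite ?mulr1 ?mulr0.
Qed.

(** E' = (i+1) d_i X^i E would hold for the full series; truncating only disturbs
    it in degrees at least K. *)
Lemma deriv_exp_factor K i : exists r : {poly F},
  (exp_factor K i)^`() =
    ((i.+1%:R * d i) *: 'X^i) * exp_factor K i + 'X^K * r.
Proof.
exists (- ((i.+1%:R * d i * (d i ^+ K / K`!%:R)) *: 'X^(i + i * K))).
rewrite mulrN -scalerAr -exprD.
have -> : (K + (i + i * K) = i + i.+1 * K)%N by lia.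
rewrite /exp_factor [in RHS]big_ord_recr /= mulrDr.
rewrite mul_monomials addrK.
rewrite linear_sum big_ord_recl /= muln0 expr0 derivZ derivC scaler0 add0r.
rewrite mulr_sumr; apply: eq_bigr => k _.
rewrite derivZ derivXn mul_monomials /bump leq0n add1n.
have -> : ((i.+1 * k.+1).-1 = i + i.+1 * k)%N by lia.
rewrite -scalerMnr scalerMnl -mulr_natr exprS factS !natrM; congr (_ *: _).
have k0 : k`!%:R != 0 :> F by rewrite pnatr_eq0 -lt0n fact_gt0.
by field; rewrite k0 /= addrC natr1 pnatr_eq0.
Qed.

Lemma deriv_prod_exp_factor K L : exists r : {poly F},
  (\prod_(i < L) exp_factor K i)^`() =
    (\sum_(i < L) (i.+1%:R * d i) *: 'X^i) * \prod_(i < L) exp_factor K i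
      + 'X^K * r.
Proof.
elim: L => [|L [r IH]].
  by exists 0; rewrite !big_ord0 derivC mul0r mulr0 addr0.
have [s Es] := deriv_exp_factor K L.
exists (r * exp_factor K L + (\prod_(i < L) exp_factor K i) * s).
rewrite !big_ord_recr /= derivM IH Es; ring.
Qed.

Lemma coef0_exp_factor K i : (exp_factor K i)`_0 = 1.
Proof.
rewrite /exp_factor big_ord_recl coefD coefZ muln0 coefXn /= expr0 invr1 !mulr1.
rewrite coef_sum big1 ?addr0// => k _.
by rewrite coefZ coefXn /bump leq0n add1n mulnS /= mulr0.
Qed.

(** The recursion is the coefficient of X^n in H' = (\sum_i (i+1) d_i X^i) H. Its
    degrees below m are unaffected by the truncation at m. *)
Lemma exp_coef_unique (m : nat) (h : nat -> F) : h 0 = 1 ->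
  (forall n, (n < m)%N ->
     n.+1%:R * h n.+1 = \sum_(i < n.+1) i.+1%:R * d i * h (n - i)%N) ->
  h m = exp_coef m.
Proof.
move=> h0 hS; rewrite exp_coefE.
set P := \prod_(i < m) _.
suff: forall n, (n <= m)%N -> h n = P`_n by apply.
have P0 : P`_0 = 1.
  rewrite /P -horner_coef0 horner_prod big1// => i _.
  by rewrite horner_coef0 coef0_exp_factor.
elim/ltn_ind => -[_ _|n IH nm]; first by rewrite h0 P0.
have n0 : n.+1%:R != 0 :> F by rewrite pnatr_eq0.
apply: (mulfI n0); rewrite hS// mulr_natl -coef_deriv.
have [r ->] := deriv_prod_exp_factor m m.
rewrite coefD coefXnM nm addr0 mulr_suml coef_sum -/P.
rewrite (big_ord_widen _ (fun i => i.+1%:R * d i * h (n - i)%N) nm) big_mkcond /=.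
apply: eq_bigr => i _; rewrite -[in RHS]mul_polyC -[in RHS](mulrA _%:P) coefCM coefXnM ltnS ltnNge.
case: leqP => //= [ni|]; last by rewrite mulr0.
by rewrite IH// ?ltnS ?leq_subr// (leq_trans (leq_subr _ _))// ltnW.
Qed.

End Exponential.

(** * Newton's identities *)

Lemma coef_mul_1subX (F : comNzRingType) (P : {poly F}) (a : F) j :
  (P * (1 - a *: 'X))`_j = P`_j - a * (if j is i.+1 then P`_i else 0).
Proof.
rewrite mulrBr mulr1 coefB [P * _]mulrC -mul_polyC -(mulrA _%:P) coefCM coefXM.
by case: j.
Qed.

(** Induction on the number of factors: the terms brought in by the new factor
    form a telescoping sum ([new_terms]). *)
Lemma coef_prod_newton (F : numFieldType) (n : nat) (x : nat -> F) (j : nat) :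
  let P := \prod_(k < n) (1 - x k *: 'X) in
  j.+1%:R * P`_j.+1 = - \sum_(i < j.+1) (\sum_(k < n) x k ^+ i.+1) * P`_(j - i).
Proof.
elim: n j => [|n IH] j /=.
  rewrite big_ord0 coef1 mulr0 big1 ?oppr0// => i _.
  by rewrite big_ord0 mul0r.
rewrite big_ord_recr /=; set P := \prod_(k < n) _.
have PS l : (P * (1 - x n *: 'X))`_l.+1 = P`_l.+1 - x n * P`_l.
  by rewrite coef_mul_1subX.
have P0 : (P * (1 - x n *: 'X))`_0 = P`_0.
  by rewrite coef_mul_1subX mulr0 subr0.
have new_terms l : \sum_(i < l.+1) x n ^+ i.+1 * (P * (1 - x n *: 'X))`_(l - i) = x n * P`_l.
  elim: l => [|l IHl]; first by rewrite big_ord1 P0 expr1.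
  rewrite big_ord_recl subn0 PS.
  under eq_bigr => i _ do rewrite lift0 subSS exprS -mulrA.
  by rewrite -mulr_sumr IHl; ring.
under eq_bigr => i _ do rewrite big_ord_recr mulrDl.
rewrite big_split new_terms.
have -> : \sum_(i < j.+1) (\sum_(k < n) x k ^+ i.+1) * (P * (1 - x n *: 'X))`_(j - i)
   = \sum_(i < j.+1) (\sum_(k < n) x k ^+ i.+1) * P`_(j - i)
     - x n * \sum_(i < j) (\sum_(k < n) x k ^+ i.+1) * P`_(j.-1 - i).
  rewrite [in LHS]big_ord_recr [X in _ = X - _]big_ord_recr /= !subnn P0.
  rewrite addrAC; congr (_ + _); rewrite mulr_sumr -sumrB; apply: eq_bigr => i _.
  have -> : (j - i = (j.-1 - i).+1)%N by case: i => i /=; lia.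
  by rewrite PS /= mulrBr mulrCA.
rewrite PS mulrBr IH -/P; case: j => [|j] /=.
  by rewrite big_ord0 mul1r mulr0 subr0 opprD.
have := IH j; rewrite /= -/P; set T' := \sum_(i < j.+1) _ => IHj.
have -> : T' = - (j.+1%:R * P`_j.+1) by rewrite IHj opprK.
rewrite -[j.+2%:R]natr1; move: (\sum_(i < j.+2) _) (P`_j.+1) => a b; ring.
Qed.

Lemma coef_prod_power_sums (F : numFieldType) (n : nat) (x : nat -> F) (m : nat) :
  (\prod_(k < n) (1 - x k *: 'X))`_m
  = exp_coef (fun i => - (\sum_(k < n) x k ^+ i.+1) / i.+1%:R) m.
Proof.
apply: (@exp_coef_unique _ _ _ (fun m => (\prod_(k < n) (1 - x k *: 'X))`_m)).
  rewrite -horner_coef0 horner_prod big1// => k _.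
  by rewrite !hornerE; ring.
move=> l _; rewrite coef_prod_newton -sumrN; apply: eq_bigr => i _.
by rewrite -mulNr; congr (_ * _); rewrite mulrC divfK// pnatr_eq0.
Qed.

(** * Multiple angles and the squares of cotangents *)

Section Tangent.
Variable R : realType.
Implicit Types t x : R.

(** cos (N t) and sin (N t) are cos^N t times the even and odd parts of
    (1 + i tan t)^N; these are the two parts as polynomials in tan^2 t, with a
    factor tan t taken out of the odd one. *)
Definition tan_even (N : nat) : {poly R} :=
  \poly_(j < N.+1) ((-1) ^+ j * 'C(N, 2 * j)%:R).
Definition tan_odd (N : nat) : {poly R} :=
  \poly_(j < N.+1) ((-1) ^+ j * 'C(N, (2 * j).+1)%:R).

Lemma coef_tan_even N j : (tan_even N)`_j = (-1) ^+ j * 'C(N, 2 * j)%:R.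
Proof.
by rewrite coef_poly; case: ltnP => // Nj; rewrite bin_small ?mulr0//; lia.
Qed.

Lemma coef_tan_odd N j : (tan_odd N)`_j = (-1) ^+ j * 'C(N, (2 * j).+1)%:R.
Proof.
by rewrite coef_poly; case: ltnP => // Nj; rewrite bin_small ?mulr0//; lia.
Qed.

Lemma tan_evenS N : tan_even N.+1 = tan_even N - 'X * tan_odd N.
Proof.
apply/polyP => -[|j]; rewrite coefB coefXM !coef_tan_even /= ?coef_tan_odd.
  by rewrite muln0 !bin0 subr0.
have -> : (2 * j.+1 = (2 * j).+2)%N by lia.
by rewrite binS natrD exprS; ring.
Qed.

Lemma tan_oddS N : tan_odd N.+1 = tan_odd N + tan_even N.
Proof.
apply/polyP => j; rewrite coefD !coef_tan_odd coef_tan_even.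
by rewrite binS natrD mulrDr.
Qed.

Lemma cos_sin_mul N t : cos t != 0 ->
  cos (N%:R * t) = cos t ^+ N * (tan_even N).[tan t ^+ 2] /\
  sin (N%:R * t) = cos t ^+ N * (tan t * (tan_odd N).[tan t ^+ 2]).
Proof.
move=> ct; have st : sin t = cos t * tan t by rewrite /tan mulrC divfK.
elim: N => [|N [IHc IHs]].
  rewrite mul0r cos0 sin0 expr0 !mul1r !horner_poly !big_ord1 !expr0 !mul1r.
  by rewrite /= !mulr1 mulr0.
rewrite -natr1 mulrDl mul1r cosD sinD IHc IHs st tan_evenS tan_oddS.
rewrite hornerD hornerN hornerM hornerX hornerD [cos t ^+ N.+1]exprS.
by move: (tan_even N).[_] (tan_odd N).[_] => A B; split; ring.
Qed.

Lemma sin_le_id x : 0 <= x -> sin x <= x.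
Proof.
move=> x0; rewrite -subr_ge0.
have [c _ /=] : exists2 c, c \in `[0, x] &
    (x - sin x) - (0 - sin 0) = (1 - cos c) * (x - 0).
  apply: (@MVT_segment _ (fun y => y - sin y) (fun y => 1 - cos y)) => //.
  apply: continuous_subspaceT => y; apply: continuousB; first exact: cvg_id.
  exact: continuous_sin.
by rewrite sin0 !subr0 => ->; rewrite mulr_ge0// subr_ge0 cos_le1.
Qed.

Lemma id_le_tan x : 0 <= x < pi / 2 -> x <= tan x.
Proof.
move=> /andP[x0 xpi]; rewrite -subr_ge0.
have cgt0 c : 0 <= c <= x -> 0 < cos c.
  move=> /andP[c0 cx]; apply: cos_gt0_pihalf.
  by rewrite (le_lt_trans cx)// andbT (lt_le_trans _ c0)// oppr_lt0 divr_gt0 ?pi_gt0.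
have [c] : exists2 c, c \in `[0, x] &
    (tan x - x) - (tan 0 - 0) = ((cos c) ^- 2 - 1) * (x - 0).
  apply: (@MVT_segment _ (fun y => tan y - y) (fun y => (cos y) ^- 2 - 1)) => //.
    move=> c; rewrite in_itv/= => /andP[c0 cx].
    have cc : cos c != 0 by rewrite gt_eqF// cgt0// !ltW.
    by have := is_derive_tan cc => ?; exact: is_deriveB.
  apply: continuous_in_subspaceT => c; rewrite inE/= in_itv/= => cI.
  apply: continuousB; last exact: cvg_id.
  by apply: continuous_tan; rewrite gt_eqF// cgt0.
rewrite in_itv/= => /cgt0 cc; rewrite tan0 !subr0 => ->.
by rewrite mulr_ge0// subr_ge0 invf_ge1 ?exprn_gt0// exprn_ile1 ?cos_le1 ?ltW.
Qed.

(** This is sin x <= x <= tan x, since cot^2 = 1/sin^2 - 1. *)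
Lemma cot2_bounds x : 0 < x < pi / 2 ->
  (x ^+ 2)^-1 - 1 <= (tan x ^+ 2)^-1 <= (x ^+ 2)^-1.
Proof.
move=> /andP[x0 xpi]; have xtan : x <= tan x by rewrite id_le_tan// ltW.
have s0 : 0 < sin x by rewrite sin_gt0_pihalf// x0.
apply/andP; split; last first.
  have t0 := lt_le_trans x0 xtan.
  by rewrite lef_pV2 ?posrE ?exprn_gt0// lerXn2r ?nnegrE ?(ltW x0) ?(ltW t0).
rewrite lerBlDr /tan expr_div_n invf_div cos2sin2 mulrBl mul1r divff ?subrK.
  by rewrite lef_pV2 ?posrE ?exprn_gt0// lerXn2r ?nnegrE ?(ltW x0) ?(ltW s0)// sin_le_id ?ltW.
by rewrite expf_neq0// gt_eqF.
Qed.

Definition angle (n k : nat) : R := k.+1%:R * (pi / n.*2.+1%:R).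

Lemma angle_bounds n k : (k < n)%N -> 0 < angle n k < pi / 2.
Proof.
move=> kn; rewrite /angle mulr_gt0 ?divr_gt0 ?pi_gt0//=.
rewrite mulrCA ltr_pM2l ?pi_gt0// ltr_pdivrMr// mulrC ltr_pdivlMr//.
by rewrite -natrM ltr_nat; lia.
Qed.

Lemma tan_angle_gt0 n k : (k < n)%N -> 0 < tan (angle n k).
Proof.
move=> kn; have ab := angle_bounds kn; have /andP[a0 api] := ab.
by rewrite (lt_le_trans a0)// id_le_tan// api ltW.
Qed.

Lemma root_tan_odd n k : (k < n)%N ->
  root (tan_odd n.*2.+1) (tan (angle n k) ^+ 2).
Proof.
move=> kn; have ab := angle_bounds kn; have /andP[a0 api] := ab.
have c0 : cos (angle n k) != 0.
  rewrite gt_eqF// cos_gt0_pihalf// api andbT (lt_trans _ a0)//.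
  by rewrite oppr_lt0 divr_gt0 ?pi_gt0.
have [_ ] := cos_sin_mul n.*2.+1 c0.
have -> : sin (n.*2.+1%:R * angle n k) = 0.
  have -> : n.*2.+1%:R * angle n k = pi *+ k.+1.
    by rewrite /angle mulrCA [X in _ * X]mulrC divfK// mulr_natl.
  elim: k.+1 => [|j IH]; first by rewrite mulr0n sin0.
  by rewrite mulrSr sinDpi IH oppr0.
move/esym/eqP; rewrite mulf_eq0 expf_eq0 (negbTE c0) andbF /= mulf_eq0.
by rewrite (gt_eqF (tan_angle_gt0 kn)).
Qed.

Lemma tan_angle_inj n k l : (k < n)%N -> (l < n)%N ->
  tan (angle n k) ^+ 2 = tan (angle n l) ^+ 2 -> k = l.
Proof.
move=> kn ln; move/(pexpIrn (isT : (0 < 2)%N)).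
rewrite !nnegrE !ltW ?tan_angle_gt0// => /(_ isT isT) tkl.
have inI j : (j < n)%N -> angle n j \in `](- (pi / 2)), (pi / 2)[.
  move=> /angle_bounds/andP[a0 api]; rewrite in_itv/= api andbT.
  by rewrite (lt_trans _ a0)// oppr_lt0 divr_gt0 ?pi_gt0.
have := tan_inj (inI _ kn) (inI _ ln) tkl; rewrite /angle.
move=> /mulIf; rewrite gt_eqF ?divr_gt0 ?pi_gt0// => /(_ isT)/eqP.
by rewrite eqr_nat => /eqP[].
Qed.

Lemma horner_1subX (c a : R) : (1 - c *: 'X).[a] = 1 - c * a.
Proof. by rewrite hornerD hornerN hornerZ hornerX -[1]/(1%:P) hornerC. Qed.

Lemma size_prod_1subX n (x : nat -> R) :
  (size (\prod_(k < n) (1 - x k *: 'X))%R <= n.+1)%N.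
Proof.
elim: n => [|n IH]; first by rewrite big_ord0 size_poly1.
rewrite big_ord_recr/= (leq_trans (size_polyMleq _ _))//.
have : (size (1 - x n *: 'X : {poly R})%R <= 2)%N.
  rewrite (leq_trans (size_polyD _ _))// geq_max size_poly1 size_polyN.
  by rewrite (leq_trans (size_scale_leq _ _))// size_polyX.
by move=> /(leq_add IH); move: (_ + _)%N => s; lia.
Qed.

(** Both sides have degree at most n; they agree at 0 and at the n distinct roots
    tan^2(k pi/N) of the left-hand side. *)
Lemma tan_odd_factorization n :
  tan_odd n.*2.+1 = n.*2.+1%:R *:
    \prod_(k < n) (1 - (tan (angle n k) ^+ 2)^-1 *: 'X).
Proof.
set P := \prod_(k < n) _; apply/eqP; rewrite -subr_eq0; apply/eqP.
set rs := 0 :: [seq tan (angle n k) ^+ 2 | k <- iota 0 n].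
apply: (@roots_geq_poly_eq0 _ _ rs).
- rewrite /=; apply/andP; split.
    rewrite /root hornerD hornerN hornerZ horner_coef0 coef_tan_odd expr0 mul1r.
    rewrite muln0 bin1 /P horner_prod big1 ?mulr1 ?subrr// => i _.
    by rewrite horner_1subX mulr0 subr0.
  apply/allP => _ /mapP[k + ->]; rewrite mem_iota add0n /= => kn.
  have := root_tan_odd kn; rewrite /root hornerD hornerN hornerZ => /eqP ->.
  rewrite /P horner_prod (bigD1 (Ordinal kn))//= horner_1subX mulVf.
    by rewrite subrr mul0r mulr0 subrr.
  by rewrite expf_neq0// gt_eqF// tan_angle_gt0.
- rewrite /= map_inj_in_uniq ?iota_uniq ?andbT.
    apply/mapP => -[k]; rewrite mem_iota add0n /= => kn /esym/eqP.
    by rewrite expf_eq0 gt_eqF ?tan_angle_gt0.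
  move=> k l; rewrite !mem_iota !add0n /= => kn ln; exact: tan_angle_inj.
- rewrite /= size_map size_iota (leq_trans (size_polyD _ _))// geq_max size_polyN.
  apply/andP; split.
    by apply/leq_sizeP => j nj; rewrite coef_tan_odd bin_small ?mulr0//; lia.
  apply: leq_trans (size_scale_leq _ _) _.
  exact: (@size_prod_1subX n (fun k => (tan (angle n k) ^+ 2)^-1)).
Qed.

End Tangent.

(** * Limits of power sums and of their partition sums *)

Section Limits.
Variable R : realType.

Lemma cvg_exp_coef (d : nat -> nat -> R) (l : nat -> R) m :
  (forall i, d ^~ i @ \oo --> l i) ->
  (fun n => exp_coef (d n) m) @ \oo --> exp_coef l m.
Proof.
move=> dl; apply: cvg_big => [|y _]; first exact: add_continuous.
apply: cvg_big => [|i _]; first exact: mul_continuous.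
by apply: cvgMr_tmp; exact: (cvg_comp _ _ (dl i) (@exprn_continuous _ _ _)).
Qed.

Lemma cvg_inv_odd : (fun n : nat => (n.*2.+1%:R : R)^-1) @ \oo --> (0 : R).
Proof.
apply: (@squeeze_cvgr _ _ _ _ (cst 0) harmonic); last 2 first.
- exact: cvg_cst.
- exact: cvg_harmonic.
near=> n; rewrite /= invr_ge0 ler0n /= lef_pV2 ?posrE// ler_nat ltnS -addnn.
exact: leq_addr.
Unshelve. all: by end_near. Qed.

Lemma cvg_bin_div_exp k :
  (fun n : nat => 'C(n.*2.+1, k)%:R / (n.*2.+1%:R : R) ^+ k) @ \oo
    --> (k`!%:R : R)^-1.
Proof.
elim: k => [|k IH].
  have -> : (fun n : nat => 'C(n.*2.+1, 0)%:R / (n.*2.+1%:R : R) ^+ 0) = cst 1.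
    by apply/funext => n; rewrite bin0 expr0 divr1.
  by rewrite fact0 invr1; exact: cvg_cst.
have -> : (fun n : nat => 'C(n.*2.+1, k.+1)%:R / (n.*2.+1%:R : R) ^+ k.+1) =
    (fun n => ('C(n.*2.+1, k)%:R / (n.*2.+1%:R : R) ^+ k) *
              ((1 - k%:R * (n.*2.+1%:R)^-1) / k.+1%:R)).
  apply/funext => n; move: n.*2 => N.
  have E : k.+1%:R * 'C(N.+1, k.+1)%:R
           = (N.+1%:R - k%:R) * 'C(N.+1, k)%:R :> R.
    rewrite -natrM mul_bin_left natrM; case: (leqP k N.+1) => kN.
      by rewrite natrB.
    by rewrite bin_small// !mulr0.
  have -> : 'C(N.+1, k.+1)%:R = (N.+1%:R - k%:R) * 'C(N.+1, k)%:R / k.+1%:R :> R.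
    by rewrite -E mulrC mulKf// pnatr_eq0.
  have N0 : N.+1%:R != 0 :> R by rewrite pnatr_eq0.
  have k0 : k.+1%:R != 0 :> R by rewrite pnatr_eq0.
  rewrite exprS; move: (N.+1%:R) N0 (k.+1%:R) k0 => a a0 b b0.
  by field; rewrite a0 b0 expf_neq0.
rewrite factS natrM invfM mulrC.
apply: cvgM => //; rewrite -[X in _ --> X]mul1r.
apply: cvgMr_tmp; rewrite -[X in _ --> X]subr0 -(mulr0 k%:R).
apply: cvgB; first exact: cvg_cst.
by apply: cvgMl_tmp; exact: cvg_inv_odd.
Qed.

Definition inv_sq (k : nat) : R := (k.+1%:R ^+ 2)^-1.
(** The scaling by (pi/N)^2 makes this tend to [inv_sq k] as n grows. *)
Definition scaled_cot2 (n k : nat) : R :=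
  (pi / n.*2.+1%:R) ^+ 2 * (tan (angle R n k) ^+ 2)^-1.

Lemma scaled_cot2_bounds n k : (k < n)%N ->
  inv_sq k - (pi / n.*2.+1%:R) ^+ 2 <= scaled_cot2 n k <= inv_sq k.
Proof.
move=> kn; have /andP[lo up] := cot2_bounds (angle_bounds R kn).
set a := pi / n.*2.+1%:R; have a0 : 0 < a by rewrite divr_gt0 ?pi_gt0.
have aE : a ^+ 2 * (angle R n k ^+ 2)^-1 = inv_sq k.
  rewrite /angle -/a /inv_sq.
  have k0 : k.+1%:R != 0 :> R by rewrite pnatr_eq0.
  move: a a0 (k.+1%:R) k0 => a a0 K k0.
  by field; rewrite k0 gt_eqF.
rewrite -aE -[X in _ - X]mulr1 -mulrBr /scaled_cot2 -/a.
by rewrite !ler_pM2l ?exprn_gt0// lo up.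
Qed.

Lemma inv_sq_ge0 k : 0 <= inv_sq k.
Proof. by rewrite invr_ge0 exprn_ge0. Qed.

Lemma inv_sq_le1 k : inv_sq k <= 1.
Proof. by rewrite invf_le1 ?exprn_gt0// exprn_ege1// ler1n. Qed.

Lemma exprS_sub_le (x y : R) i : 0 <= y <= x -> x <= 1 ->
  0 <= x ^+ i.+1 - y ^+ i.+1 <= i.+1%:R * (x - y).
Proof.
move=> /andP[y0 yx] x1; have x0 := le_trans y0 yx; have y1 := le_trans yx x1.
rewrite subr_ge0 lerXn2r//= subrXX mulrC ler_wpM2r ?subr_ge0//.
rewrite -[X in _ <= X%:R](card_ord i.+1) -sumr_const ler_sum// => j _.
by rewrite mulr_ile1 ?exprn_ge0 ?exprn_ile1.
Qed.

(** Each of the n terms differs by at most (i+1) (pi/N)^2, by [exprS_sub_le], and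
    n/N <= 1. *)
Lemma power_sums_cot_near i n :
  `|\sum_(k < n) scaled_cot2 n k ^+ i.+1 - \sum_(k < n) inv_sq k ^+ i.+1|
    <= i.+1%:R * pi ^+ 2 * (n.*2.+1%:R)^-1.
Proof.
rewrite distrC -sumrB (le_trans (ler_norm_sum _ _ _))//.
set N : R := n.*2.+1%:R.
have N0 : 0 < N by rewrite ltr0n.
apply: (@le_trans _ _ (\sum_(k < n) i.+1%:R * (pi / N) ^+ 2)).
  apply: ler_sum => k _; have /andP[lo up] := scaled_cot2_bounds (ltn_ord k).
  have c0 : 0 <= scaled_cot2 n k by rewrite mulr_ge0 ?invr_ge0 ?exprn_even_ge0.
  have /andP[d0 d1] : 0 <= inv_sq k ^+ i.+1 - scaled_cot2 n k ^+ i.+1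
      <= i.+1%:R * (inv_sq k - scaled_cot2 n k).
    by apply: exprS_sub_le; rewrite ?c0 ?inv_sq_le1.
  rewrite ger0_norm// (le_trans d1)// ler_wpM2l//.
  by rewrite lerBlDr -lerBlDl.
rewrite sumr_const card_ord -[X in X <= _]mulr_natl.
have -> : n%:R * (i.+1%:R * (pi / N) ^+ 2) = (i.+1%:R * pi ^+ 2 / N) * (n%:R / N).
  by move: (n%:R : R) => a; field; rewrite gt_eqF.
rewrite ler_piMr//.
  by rewrite !mulr_ge0 ?invr_ge0 ?exprn_ge0 ?pi_ge0// ltW.
by rewrite ler_pdivrMr// mul1r ler_nat; lia.
Qed.

Lemma cvg_zeta i :
  (fun n => \sum_(k < n) inv_sq k ^+ i.+1) @ \oo --> (zeta (2 * i.+1)%:R : R).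
Proof.
have E : (fun n => \sum_(k < n) inv_sq k ^+ i.+1)
       = series (fun n : nat => (n.+1%:R `^ (2 * i.+1)%:R)^-1 : R).
  apply/funext => n; rewrite /series /= big_mkord; apply: eq_bigr => k _.
  by rewrite powR_mulrn// exprM exprVn.
rewrite E /zeta; apply: (_ : cvgn _); rewrite -E.
apply: nondecreasing_is_cvgn.
  apply/nondecreasing_seqP => n; rewrite big_ord_recr/= lerDl.
  by rewrite exprn_ge0// inv_sq_ge0.
exists 2 => _ [n _ <-].
have inv_sq_pow k : inv_sq k ^+ i.+1 <= inv_sq k.
  by rewrite exprSr ler_piMl ?inv_sq_ge0// exprn_ile1 ?inv_sq_ge0 ?inv_sq_le1.
(* The terms 1/(k+1)^2, k > 0, are compared with 1/k - 1/(k+1), which telescopes.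
   For n = 0 the bound reads 2, since the inverse of 0 is 0. *)
suff: \sum_(k < n) inv_sq k ^+ i.+1 <= 2 - n%:R^-1.
  by move=> /le_trans; apply; rewrite gerBl invr_ge0.
elim: n => [|[|n] IH]; first by rewrite big_ord0 invr0; lra.
  rewrite big_ord1 (le_trans (inv_sq_pow 0%N))// (le_trans (inv_sq_le1 0))//.
  by rewrite invr1; lra.
rewrite big_ord_recr/= (le_trans (lerD IH (inv_sq_pow n.+1)))//.
rewrite /inv_sq -[n.+2%:R]natr1; have : 0 < n.+1%:R :> R by rewrite ltr0n.
move: n.+1%:R => a a0; rewrite -addrA lerD2l lerNr opprD opprK -subr_ge0.
have -> : a^-1 - ((a + 1) ^+ 2)^-1 - (a + 1)^-1 = (a * (a + 1) ^+ 2)^-1.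
  by field; rewrite !gt_eqF ?ltr_wpDr ?ltW.
by rewrite invr_ge0 mulr_ge0 ?exprn_ge0 ?addr_ge0// ltW.
Qed.

Lemma cvg_power_sums_cot i :
  (fun n => \sum_(k < n) scaled_cot2 n k ^+ i.+1) @ \oo --> (zeta (2 * i.+1)%:R : R).
Proof.
have h : (fun n => \sum_(k < n) scaled_cot2 n k ^+ i.+1
                   - \sum_(k < n) inv_sq k ^+ i.+1) @ \oo --> (0 : R).
  apply/norm_cvg0P.
  apply: (@squeeze_cvgr _ _ _ _ (cst 0)
    (fun n : nat => i.+1%:R * pi ^+ 2 * (n.*2.+1%:R)^-1)).
  - by near=> n; rewrite /= normr_ge0 power_sums_cot_near.
  - exact: cvg_cst.
  - have := @cvgMl_tmp _ _ _ _ _ (i.+1%:R * pi ^+ 2) _ cvg_inv_odd; rewrite mulr0; apply.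
have -> : (fun n => \sum_(k < n) scaled_cot2 n k ^+ i.+1) =
    (fun n => (\sum_(k < n) scaled_cot2 n k ^+ i.+1
               - \sum_(k < n) inv_sq k ^+ i.+1) + \sum_(k < n) inv_sq k ^+ i.+1).
  by apply/funext => n; rewrite subrK.
by rewrite -[X in _ --> X]add0r; apply: cvgD h _; exact: cvg_zeta.
Unshelve. all: by end_near. Qed.

Lemma coef_prod_scale (c : R) (x : nat -> R) n m :
  (\prod_(k < n) (1 - (c * x k) *: 'X))`_m
  = c ^+ m * (\prod_(k < n) (1 - x k *: 'X))`_m.
Proof.
elim: n m => [|n IH] m.
  by rewrite !big_ord0 coef1; case: m => [|m]; rewrite ?mulr0// expr0 mul1r.
rewrite !big_ord_recr/= !coef_mul_1subX IH; case: m => [|m]; first by rewrite !mulr0 !subr0.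
by rewrite IH exprS; ring.
Qed.

(** The limit of the coefficient of X^m in \prod_(k < n) (1 - X/(k+1)^2). *)
Definition zeta_coef : nat -> R :=
  exp_coef (fun i => - zeta (2 * i.+1)%:R / i.+1%:R).

Lemma cvg_coef_inv_sq m :
  (fun n => (\prod_(k < n) (1 - inv_sq k *: 'X))`_m) @ \oo --> zeta_coef m.
Proof.
under eq_fun do rewrite coef_prod_power_sums.
apply: cvg_exp_coef => i; apply: cvgMr_tmp; apply: cvgN; exact: cvg_zeta.
Qed.

(** The coefficients of \prod_k (1 - v_k X), v_k the scaled cotangents, have two
    limits: one through their power sums, one through binomial coefficients. *)
Lemma zeta_coefE m : zeta_coef m = (-1) ^+ m * (pi ^+ (2 * m) / ((2 * m).+1)`!%:R).
Proof.
have h1 : (fun n => (\prod_(k < n) (1 - scaled_cot2 n k *: 'X))`_m) @ \oo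
    --> zeta_coef m.
  under eq_fun do rewrite coef_prod_power_sums.
  apply: cvg_exp_coef => i; apply: cvgMr_tmp; apply: cvgN.
  exact: cvg_power_sums_cot.
have h2 : (fun n => (\prod_(k < n) (1 - scaled_cot2 n k *: 'X))`_m) @ \oo
    --> ((-1) ^+ m * (pi ^+ (2 * m) / ((2 * m).+1)`!%:R) : R).
  have -> : (fun n => (\prod_(k < n) (1 - scaled_cot2 n k *: 'X))`_m)
     = (fun n => (-1) ^+ m * (pi ^+ (2 * m) *
          ('C(n.*2.+1, (2 * m).+1)%:R / (n.*2.+1%:R : R) ^+ (2 * m).+1))).
    apply/funext => n; rewrite /scaled_cot2.
    rewrite (@coef_prod_scale _ (fun k => (tan (angle R n k) ^+ 2)^-1)).
    have := congr1 (fun p : {poly R} => p`_m) (tan_odd_factorization R n).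
    rewrite coefZ coef_tan_odd; set c := _`_m.
    have N0 : n.*2.+1%:R != 0 :> R by rewrite pnatr_eq0.
    move: (n.*2.+1%:R : R) N0 => N N0 E.
    have -> : c = (-1) ^+ m * 'C(n.*2.+1, (2 * m).+1)%:R / N.
      by rewrite E mulrC mulKf.
    rewrite -exprM expr_div_n exprS; field.
    by rewrite N0 expf_neq0.
  apply: cvgMl_tmp; apply: cvgMl_tmp; exact: cvg_bin_div_exp.
exact: (cvg_unique _ h1 h2).
Qed.

End Limits.

(** * Sums over strictly increasing tuples *)

Section StrictlyIncreasing.
Variable R : realType.

Definition increasing_tuples (m : nat) : set (m.-tuple nat) :=
  [set N : m.-tuple nat |
    (forall i : 'I_m, (1 <= tnth N i)%N) /\
    (forall i j : 'I_m, (i < j)%N -> (tnth N i < tnth N j)%N)].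
Arguments increasing_tuples : clear implicits.

Definition increasing_below (m n : nat) : set (m.-tuple nat) :=
  increasing_tuples m `&` [set N | forall i : 'I_m, (tnth N i <= n)%N].
Arguments increasing_below : clear implicits.

Lemma tnth_rcons_widen m (N : m.-tuple nat) v (i : 'I_m) :
  tnth (rcons_tuple N v) (widen_ord (leqnSn m) i) = tnth N i.
Proof. by rewrite (tnth_nth v) [in RHS](tnth_nth v)/= nth_rcons size_tuple ltn_ord. Qed.

Lemma tnth_rcons_max m (N : m.-tuple nat) v :
  tnth (rcons_tuple N v) ord_max = v.
Proof. by rewrite (tnth_nth v)/= nth_rcons size_tuple ltnn eqxx. Qed.

Lemma ordS_case m (P : 'I_m.+1 -> Prop) :
  (forall i : 'I_m, P (widen_ord (leqnSn m) i)) -> P ord_max -> forall i, P i.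
Proof.
move=> Pw Pm i; have := ltn_ord i; rewrite ltnS leq_eqVlt => /orP[/eqP im|im].
  by rewrite (_ : i = ord_max)//; apply/val_inj.
by rewrite (_ : i = widen_ord (leqnSn m) (Ordinal im))//; apply/val_inj.
Qed.

(** The increasing tuples with values at most n+1 that are not bounded by n are
    those ending with n+1. *)
Lemma increasing_belowS m n :
  increasing_below m.+1 n.+1 `&` ~` [set N | forall i, (tnth N i <= n)%N]
  = (fun N : m.-tuple nat => rcons_tuple N n.+1) @` increasing_below m n.
Proof.
apply/seteqP; split => [N [[[pos inc] le]] nle|_ [N [[pos inc] le] <-]].
  have Nmax : tnth N ord_max = n.+1.
    apply/eqP; rewrite eqn_leq le ltnNge; apply/negP => maxn; apply: nle.
    apply: ordS_case => // i; apply: leq_trans maxn; rewrite ltnW//.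
    by apply: inc; exact: (ltn_ord i).
  exists [tuple tnth N (widen_ord (leqnSn m) i) | i < m].
    split; first split => [i|i j ij]; rewrite ?tnth_mktuple//.
      by apply: inc.
    by move=> i /=; rewrite tnth_mktuple -ltnS -Nmax; apply: inc; exact: (ltn_ord i).
  apply: eq_from_tnth; apply: ordS_case => [i|].
    by rewrite tnth_rcons_widen tnth_mktuple.
  by rewrite tnth_rcons_max Nmax.
split; last by move=> /(_ ord_max); rewrite tnth_rcons_max ltnn.
split; first split.
- by apply: ordS_case => [i|]; rewrite ?tnth_rcons_widen ?tnth_rcons_max.
- apply: ordS_case => [i|]; apply: ordS_case => [j|] /= ij.
  + by rewrite !tnth_rcons_widen; exact: inc.
  + by rewrite tnth_rcons_widen tnth_rcons_max ltnS; exact: le.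
  + by move: ij; rewrite ltnNge ltnW.
  + by move: ij; rewrite ltnn.
- apply: ordS_case => [i|] /=; rewrite ?tnth_rcons_widen ?tnth_rcons_max//.
  by rewrite ltnW// ltnS; exact: le.
Qed.

(** The split according to the last entry is the recursion for the coefficients
    of \prod_(k < n) (1 - x_k X). The constant c absorbs the weight of the last
    entry in the induction. *)
Lemma esum_increasing_below (x : nat -> R) (x0 : forall k, 0 <= x k) m n (c : R) :
  0 <= c ->
  \esum_(N in increasing_below m n) (c * \prod_(i < m) x (tnth N i).-1)%:E
  = (c * ((-1) ^+ m * (\prod_(k < n) (1 - x k *: 'X))`_m))%:E.
Proof.
have term_ge0 j (d : R) (N : j.-tuple nat) : 0 <= d ->
    (0 <= (d * \prod_(i < j) x (tnth N i).-1)%:E)%E.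
  by move=> d0; rewrite lee_fin mulr_ge0// prodr_ge0.
elim: n m c => [|n IH] [|m] c c0.
- rewrite (_ : increasing_below 0 0 = [set [tuple]]) ?esum_set1 ?term_ge0//.
    by rewrite !big_ord0 expr0 coef1 !mulr1.
  apply/seteqP; split => [N _|_ ->]; first by rewrite /= [N]tuple0.
  by split; [split|] => -[].
- rewrite (_ : increasing_below _ _ = set0) ?esum_set0.
    by rewrite big_ord0 coef1 !mulr0.
  apply/seteqP; split => // N [[pos _] /(_ ord0)].
  by rewrite leqNgt pos.
- rewrite (_ : increasing_below 0 _ = [set [tuple]]) ?esum_set1 ?term_ge0//.
    rewrite big_ord0 expr0 mul1r -horner_coef0 horner_prod.
    by rewrite big1// => k _; rewrite horner_1subX mulr0 subr0.
  apply/seteqP; split => [N _|_ ->]; first by rewrite /= [N]tuple0.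
  by split; [split|] => -[].
rewrite (esumID [set N | forall i, (tnth N i <= n)%N]); last first.
  by move=> N _; exact: term_ge0.
have -> : increasing_below m.+1 n.+1 `&` [set N | forall i, (tnth N i <= n)%N]
    = increasing_below m.+1 n.
  apply/seteqP; split => N; first by move=> [[inc _] le].
  by move=> [inc le]; do 2?split => //; move=> i; rewrite ltnW// ltnS le.
rewrite IH// increasing_belowS esum_image; last first.
  move=> N N' _ _ /(congr1 (fun t => tval t)) /= /rcons_inj[NN'].
  exact/val_inj.
under eq_esum => N _.
  rewrite big_ord_recr/= tnth_rcons_max/=.
  under eq_bigr do rewrite tnth_rcons_widen.
  rewrite [X in c * X]mulrC mulrA.
  over.
rewrite IH ?mulr_ge0// -EFinD; congr (_%:E).
rewrite big_ord_recr/= coef_mul_1subX /= exprS.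
by ring.
Qed.

Lemma le_esum_subset (T : choiceType) (A B : set T) (a : T -> \bar R) :
  A `<=` B -> (\esum_(i in A) a i <= \esum_(i in B) a i)%E.
Proof.
move=> AB; apply: ge_ereal_sup => _ [X [finX XA] <-]; apply: esum_ge.
by exists X => //; split => // i /XA/AB.
Qed.

(** Every finite set of increasing tuples is bounded by some n. *)
Lemma esum_increasing (x : nat -> R) (x0 : forall k, 0 <= x k) m (l : R) :
  (fun n => (-1) ^+ m * (\prod_(k < n) (1 - x k *: 'X))`_m) @ \oo --> l ->
  \esum_(N in increasing_tuples m) (\prod_(i < m) x (tnth N i).-1)%:E = l%:E.
Proof.
set e := fun n => _ => el.
pose f (N : m.-tuple nat) : \bar R := (\prod_(i < m) x (tnth N i).-1)%:E.
have eE n : \esum_(N in increasing_below m n) f N = (e n)%:E.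
  rewrite -[e n]mul1r -esum_increasing_below//; apply: eq_esum => N _.
  by rewrite mul1r.
have e_ndecr : nondecreasing_seq e.
  move=> p q pq; rewrite -lee_fin -!eE; apply: le_esum_subset.
  by move=> N [inc le]; split => // i; exact: leq_trans (le i) pq.
have el_le n : e n <= l.
  by rewrite -(cvg_lim _ el)//; apply: nondecreasing_cvgn_le => //; apply/cvg_ex; exists l.
have le_l : (\esum_(N in increasing_tuples m) f N <= l%:E)%E.
  apply: ge_ereal_sup => _ [X [finX XS] <-].
  have /finite_seqP[s XE] := finX.
  pose n := \max_(N <- s) \max_(i < m) tnth N i.
  rewrite (@le_trans _ _ (e n)%:E) ?lee_fin// -eE.
  apply: esum_ge; exists X => //; split => // N XN; split; first exact: XS.
  move=> i /=; have Ns : N \in s by move: XN; rewrite XE.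
  rewrite /n; apply: leq_trans (leq_bigmax_seq _ Ns isT).
  exact: (leq_bigmax i).
apply/eqP; rewrite eq_le le_l/=.
have ge_e n : ((e n)%:E <= \esum_(N in increasing_tuples m) f N)%E.
  by rewrite -eE; apply: le_esum_subset => N [].
case: (\esum_(N in _) _) le_l ge_e => [s| |] // _ ge_e; last by have := ge_e 0%N.
rewrite lee_fin -(cvg_lim _ el)//; apply: limr_le; first by apply/cvg_ex; exists l.
by near=> n; rewrite -lee_fin.
Unshelve. all: by end_near. Qed.

End StrictlyIncreasing.

(** * Power series that converge near 0 *)

Section PowerSeries.
Variable R : realType.
Implicit Types (a b c : nat -> R) (t : R).

(** The value at 0 is left free, so as to cover functions such as t/(e^t - 1). *)
Definition power_series_near0 c (f : R -> R) : Prop :=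
  \forall t \near (0 : R)^', series (fun k => c k * t ^+ k) @ \oo --> f t.

(** The terms of a series that converges at some nonzero t are bounded. *)
Lemma power_series_coef_bound c f : power_series_near0 c f ->
  exists2 K : R, 1 <= K & forall k, `|c k| <= K ^+ k.+1.
Proof.
move=> cf; have [t [ct t0]] :
    exists t, (series (fun k => c k * t ^+ k) @ \oo --> f t) /\ t != 0.
  near (0 : R)^' => t; exists t; split; near: t; first exact: cf.
  exact: nbhs_dnbhs_neq.
have : cvgn (series (fun k => c k * t ^+ k)) by apply/cvg_ex; exists (f t).
move=> /cvg_series_bounded/pinfty_ex_gt0[M M0 /= Mb].
have Mb' k : `|c k| * `|t| ^+ k <= M by rewrite -normrX -normrM; exact: Mb.
exists (1 + `|M| + `|t|^-1) => [|k].
  by rewrite -addrA lerDl addr_ge0 ?invr_ge0.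
have tk : 0 < `|t| ^+ k by rewrite exprn_gt0 ?normr_gt0.
have : `|c k| <= M * `|t|^-1 ^+ k by rewrite exprVn ler_pdivlMr.
move=> /le_trans; apply; rewrite exprS.
have ti : 0 <= `|t|^-1 by rewrite invr_ge0.
apply: (@le_trans _ _ (`|M| * `|t|^-1 ^+ k)).
  by rewrite ler_wpM2r ?exprn_ge0// ler_norm.
apply: ler_pM; rewrite ?exprn_ge0//.
  by rewrite -addrA addrCA lerDl addr_ge0.
by rewrite lerXn2r ?nnegrE// ?addr_ge0// lerDr addr_ge0.
Unshelve. all: by end_near. Qed.

(** With the coefficients bounded by K^(k+1), the terms other than c_0 add up to at
    most 2 K^2 |t| as soon as K |t| <= 1/2, and this can be made smaller than any e. *)
Lemma power_series_near0_coef0 c : power_series_near0 c (fun=> 0) -> c 0 = 0.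
Proof.
move=> c0; have [K K1 cK] := power_series_coef_bound c0.
have K0 : 0 < K by exact: lt_le_trans K1.
apply/eqP; rewrite -normr_eq0 eq_le normr_ge0 andbT; apply/ler_addgt0Pr => e e0.
rewrite add0r.
have d0 : 0 < Num.min (2 * K)^-1 (e / (2 * K ^+ 2)).
  by rewrite lt_min invr_gt0 divr_gt0// mulr_gt0 ?exprn_gt0.
have [t [ct]] : exists t, (series (fun k => c k * t ^+ k) @ \oo --> (0 : R)) /\
    `|t| <= Num.min (2 * K)^-1 (e / (2 * K ^+ 2)).
  near (0 : R)^' => t; exists t; split; near: t; first exact: c0.
  exact: dnbhs0_le.
rewrite /= le_min => /andP[t1 t2].
have Kt : K * `|t| <= 2^-1.
  by move: t1; rewrite invfM mulrC -ler_pdivlMl// invrK.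
suff B n : `|c 0| <= `|series (fun k => c k * t ^+ k) n.+1| + e.
  have : `|c 0| <= `|0 : R| + e.
    apply: (cvgr_to_ge (_ : (fun n =>
      `|series (fun k => c k * t ^+ k) n.+1| + e) @ \oo --> `|0 : R| + e)).
      apply: cvgD; last exact: cvg_cst.
      by apply: cvg_norm; rewrite (cvg_shiftS (series (fun k => c k * t ^+ k))).
    by near=> n.
  by rewrite normr0 add0r.
rewrite /series /= big_mkord big_ord_recl /= expr0 mulr1.
set S := \sum_(i < n) _.
rewrite -[X in `|X| <= _](addrK S) (le_trans (ler_normB _ _))// lerD2l.
apply: le_trans (ler_norm_sum _ _ _) _.
apply: (@le_trans _ _ (\sum_(i < n) (K ^+ 2 * `|t|) * 2^-1 ^+ i)).
  apply: ler_sum => i _; rewrite /bump leq0n add1n normrM normrX.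
  apply: (@le_trans _ _ (K ^+ i.+2 * `|t| ^+ i.+1)).
    by rewrite ler_wpM2r ?exprn_ge0.
  have -> : K ^+ i.+2 * `|t| ^+ i.+1 = K ^+ 2 * `|t| * (K * `|t|) ^+ i.
    by rewrite !exprS exprMn; ring.
  rewrite ler_wpM2l ?mulr_ge0 ?exprn_ge0 ?(ltW K0)// lerXn2r ?nnegrE ?invr_ge0//.
  by rewrite mulr_ge0 ?(ltW K0).
rewrite -mulr_sumr (@le_trans _ _ (K ^+ 2 * `|t| * 2))//.
  rewrite ler_wpM2l ?mulr_ge0 ?exprn_ge0 ?(ltW K0)//.
  have half0 : 0 < 2^-1 :> R by lra.
  have half1 : `|2^-1 : R| < 1 by rewrite ger0_norm; lra.
  have := geometric_le_lim n ler01 half0 half1.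
  have -> : (1 - 2^-1 : R) = 2^-1 by lra.
  rewrite mul1r invrK /series /= big_mkord.
  by move=> /(le_trans _); apply; apply: ler_sum => j _; rewrite /geometric /= mul1r.
move: t2; rewrite ler_pdivlMr ?mulr_gt0 ?exprn_gt0//.
by rewrite -[K ^+ 2 * _ * 2]mulrA [K ^+ 2 * _]mulrC -mulrA.
Unshelve. all: by end_near. Qed.

(** Once c_0 = 0, dividing by t gives a series of the same kind for the shifted
    coefficients. *)
Lemma power_series_near0_unique c : power_series_near0 c (fun=> 0) ->
  forall k, c k = 0.
Proof.
move=> + k; elim: k c => [|k IH] c c0; first exact: power_series_near0_coef0.
have c00 := power_series_near0_coef0 c0; apply: (IH (fun k => c k.+1)).
apply: filterS2 c0 (nbhs_dnbhs_neq (0 : R)) => t ct t0.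
have -> : series (fun k => c k.+1 * t ^+ k) =
    (fun n => t^-1 * series (fun k => c k * t ^+ k) n.+1).
  apply/funext => n; rewrite /series /= !big_mkord big_ord_recl c00 mul0r add0r.
  rewrite mulr_sumr; apply: eq_bigr => i _.
  by rewrite lift0 exprS mulrCA mulKf.
rewrite -(mulr0 t^-1); apply: cvgMl_tmp.
by rewrite (cvg_shiftS (series (fun k => c k * t ^+ k))).
Qed.

(** The difference consists of the terms of degree n+1 to 2n+1 of a product of
    two polynomials, whose k-th coefficient is at most (k+1) K^(k+2). *)
Lemma cauchy_partial_sum_bound (K : R) a b n t : 1 <= K ->
  (forall k, `|a k| <= K ^+ k.+1) -> (forall k, `|b k| <= K ^+ k.+1) ->
  K * `|t| <= 1 ->
  `|(\sum_(i < n.+1) a i * t ^+ i) * (\sum_(i < n.+1) b i * t ^+ i)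
    - \sum_(k < n.+1) (\sum_(j < k.+1) a j * b (k - j)%N) * t ^+ k|
  <= K ^+ 2 * ((n.+1 * (n.+1 + n.+1))%:R * (K * `|t|) ^+ n.+1).
Proof.
move=> K1 aK bK Kt; have K0 : 0 < K by exact: lt_le_trans K1.
set N := n.+1.
pose p := \poly_(i < N) a i; pose q := \poly_(i < N) b i.
have -> : \sum_(i < N) a i * t ^+ i = p.[t] by rewrite horner_poly.
have -> : \sum_(i < N) b i * t ^+ i = q.[t] by rewrite horner_poly.
rewrite -hornerM (@horner_coef_wide _ (N + N)); last first.
  apply: leq_trans (size_polyMleq _ _) _.
  by rewrite (leq_trans (leq_pred _)) // leq_add // size_poly.
have pqle i : `|(p * q)`_i| <= i.+1%:R * K ^+ i.+2.
  rewrite coefM (le_trans (ler_norm_sum _ _ _)) // mulr_natl.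
  rewrite -[X in _ *+ X](card_ord i.+1) -sumr_const ler_sum // => j _.
  have -> : i.+2 = (j.+1 + (i - j).+1)%N by case: j => j /= ?; lia.
  rewrite !coef_poly normrM exprD ler_pM //.
    by case: ifP => _; rewrite ?normr0 ?exprn_ge0 ?(ltW K0).
  by case: ifP => _; rewrite ?normr0 ?exprn_ge0 ?(ltW K0).
rewrite big_split_ord /=.
have -> : \sum_(i < N) (p * q)`_i * t ^+ i
    = \sum_(k < N) (\sum_(j < k.+1) a j * b (k - j)%N) * t ^+ k.
  apply: eq_bigr => k _; congr (_ * _); rewrite coefM; apply: eq_bigr => j _.
  rewrite !coef_poly (leq_ltn_trans (leq_subr _ _) (ltn_ord k)).
  by rewrite (leq_ltn_trans _ (ltn_ord k)) // -ltnS.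
rewrite addrAC subrr add0r (le_trans (ler_norm_sum _ _ _)) //.
rewrite natrM -mulrA mulrCA -[X in _ <= X%:R * _](card_ord N) mulr_natl -sumr_const.
apply: ler_sum => i _; rewrite normrM normrX.
apply: (@le_trans _ _ ((N + i).+1%:R * K ^+ (N + i).+2 * `|t| ^+ (N + i))).
  by rewrite ler_wpM2r ?exprn_ge0.
have -> : (N + i).+1%:R * K ^+ (N + i).+2 * `|t| ^+ (N + i)
    = K ^+ 2 * ((N + i).+1%:R * ((K * `|t|) ^+ N * (K * `|t|) ^+ i)).
  by rewrite -exprD exprMn -add2n exprD; ring.
have Kt0 : 0 <= K * `|t| by rewrite mulr_ge0 ?(ltW K0).
rewrite ler_wpM2l ?exprn_ge0 ?(ltW K0)// ler_pM ?mulr_ge0 ?exprn_ge0//.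
  by rewrite ler_nat -addnS leq_add2l.
by rewrite ler_piMr ?exprn_ge0 // exprn_ile1.
Qed.

Lemma power_series_near0_mul a b f g :
  power_series_near0 a f -> power_series_near0 b g ->
  power_series_near0 (fun k => \sum_(j < k.+1) a j * b (k - j)%N)
    (fun t => f t * g t).
Proof.
move=> af bg.
have [Ka Ka1 aK] := power_series_coef_bound af.
have [Kb Kb1 bK] := power_series_coef_bound bg.
pose K := Num.max Ka Kb.
have K1 : 1 <= K by rewrite le_max Ka1.
have K0 : 0 < K by exact: lt_le_trans K1.
have aK' k : `|a k| <= K ^+ k.+1.
  rewrite (le_trans (aK k))// lerXn2r ?nnegrE ?(ltW K0)//.
    exact: le_trans Ka1.
  by rewrite le_max lexx.
have bK' k : `|b k| <= K ^+ k.+1.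
  rewrite (le_trans (bK k))// lerXn2r ?nnegrE ?(ltW K0)//.
    exact: le_trans Kb1.
  by rewrite le_max lexx orbT.
(* For |t| at most 1/(8K), the error bound 2 N^2 (K|t|)^N is at most
   2 4^N / 8^N, which tends to 0. *)
have d0 : 0 < (8 * K)^-1 by rewrite invr_gt0 mulr_gt0.
near=> t.
have ta : series (fun k => a k * t ^+ k) @ \oo --> f t by near: t.
have tb : series (fun k => b k * t ^+ k) @ \oo --> g t by near: t.
have t8 : K * `|t| <= 8^-1.
  have : `|t| <= (8 * K)^-1 by near: t; exact: dnbhs0_le.
  by rewrite invfM mulrC -ler_pdivlMl// invrK.
have t1 : K * `|t| <= 1 by rewrite (le_trans t8)//; lra.
pose d k := \sum_(j < k.+1) a j * b (k - j)%N.
suff : series (fun k => d k * t ^+ k) @ \oo --> f t * g t by [].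
pose err n := series (fun k => a k * t ^+ k) n.+1
   * series (fun k => b k * t ^+ k) n.+1 - series (fun k => d k * t ^+ k) n.+1.
have err0 : err @ \oo --> 0.
  apply: norm_cvg0.
  apply: (@squeeze_cvgr _ _ _ _ (cst 0) (geometric (K ^+ 2) 2^-1)).
  - near=> n; rewrite /= normr_ge0 /err /series /= !big_mkord /=.
    apply: le_trans (cauchy_partial_sum_bound n K1 aK' bK' t1) _.
    rewrite ler_wpM2l ?exprn_ge0 ?(ltW K0)//.
    apply: (@le_trans _ _ ((2 * 4 ^ n.+1)%:R * 8^-1 ^+ n.+1)).
      rewrite ler_pM ?exprn_ge0 ?mulr_ge0 ?(ltW K0)//.
        have nN : (n.+1 <= 2 ^ n.+1)%N by rewrite ltnW // ltn_expl.
        by rewrite ler_nat addnn -mul2n mulnCA leq_mul2l /= (expnMn 2 2) leq_mul.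
      by rewrite lerXn2r ?nnegrE ?mulr_ge0 ?(ltW K0).
    rewrite natrM natrX -mulrA -exprMn.
    have -> : (4 * 8^-1 : R) = 2^-1 by lra.
    by rewrite exprS mulrA divff ?mul1r// pnatr_eq0.
  - exact: cvg_cst.
  - by apply: cvg_geometric; rewrite ger0_norm; lra.
rewrite -(cvg_shiftS (series (fun k => d k * t ^+ k))).
have -> : (fun n => series (fun k => d k * t ^+ k) n.+1) =
    (fun n => series (fun k => a k * t ^+ k) n.+1
      * series (fun k => b k * t ^+ k) n.+1 - err n).
  by apply/funext => n; rewrite /err opprB addrC subrK.
rewrite -[f t * g t]subr0; apply: cvgB => //; apply: cvgM.
  by rewrite (cvg_shiftS (series (fun k => a k * t ^+ k))).
by rewrite (cvg_shiftS (series (fun k => b k * t ^+ k))).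
Unshelve. all: by end_near. Qed.

Lemma power_series_near0_inj a b f :
  power_series_near0 a f -> power_series_near0 b f -> forall k, a k = b k.
Proof.
move=> af bf k; apply/eqP; rewrite -subr_eq0; apply/eqP.
apply: (power_series_near0_unique (c := fun k => a k - b k)).
apply: filterS2 af bf => t at_ bt.
have -> : series (fun k => (a k - b k) * t ^+ k) =
  (fun n => series (fun k => a k * t ^+ k) n - series (fun k => b k * t ^+ k) n).
  apply/funext => n; rewrite /series /= -sumrB; apply: eq_bigr => i _.
  by rewrite mulrBl.
by rewrite -(subrr (f t)); exact: cvgB.
Qed.

End PowerSeries.

(** * Bernoulli numbers *)

Section Bernoulli.
Variable R : realType.

Definition bernoulli_div_fact (j : nat) : R := bernoulli R j / j`!%:R.
(** The coefficients of sinh(t/2)/(t/2) = (e^(t/2) - e^(-t/2))/t, of both parities;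
    [sinhc_even] below are the nonzero ones. *)
Definition sinhc_coef (n : nat) : R := (2^-1 ^+ n.+1 - (- 2^-1) ^+ n.+1) / n.+1`!%:R.

Lemma expR_series (x t : R) :
  series (fun k => x ^+ k / k`!%:R * t ^+ k) @ \oo --> expR (x * t).
Proof.
have -> : (fun k => x ^+ k / k`!%:R * t ^+ k) = exp_coeff (x * t).
  by apply/funext => k; rewrite /exp_coeff /= exprMn mulrAC.
exact: is_cvg_series_exp_coeff.
Qed.

Lemma bernoulli_div_fact_gf : power_series_near0 bernoulli_div_fact (fun t => t / (expR t - 1)).
Proof.
apply: filterS (@bernoulliP R) => t; set u := fun j => _; set v := fun k => _.
by rewrite (_ : u = v)//; apply/funext => j; rewrite /u /v /bernoulli_div_fact mulrCA mulrC.
Qed.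

Lemma sinhc_gf : power_series_near0 sinhc_coef
  (fun t => (expR (2^-1 * t) - expR (- 2^-1 * t)) / t).
Proof.
apply: filterS (nbhs_dnbhs_neq (0 : R)) => t t0.
pose e x := series (fun k => x ^+ k / k`!%:R * t ^+ k).
have -> : series (fun k => sinhc_coef k * t ^+ k) =
    (fun n => (e 2^-1 n.+1 - e (- 2^-1) n.+1) / t).
  apply/funext => n; rewrite /e /series /= !big_mkord !big_ord_recl /=.
  rewrite !expr0 !mulr1 opprD addrACA subrr add0r -sumrB mulr_suml.
  apply: eq_bigr => i _; rewrite /bump leq0n add1n -mulrBl -mulrBl /sinhc_coef.
  by rewrite [t ^+ i.+1]exprS mulrCA [RHS]mulrC mulKf.
apply: cvgMr_tmp; apply: cvgB.
  by rewrite (cvg_shiftS (e 2^-1)); exact: expR_series.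
by rewrite (cvg_shiftS (e (- 2^-1))); exact: expR_series.
Qed.

(** This compares coefficients in t/(e^t - 1) * (e^(t/2) - e^(-t/2))/t = e^(-t/2). *)
Lemma bernoulli_sinhc_conv n :
  \sum_(j < n.+1) bernoulli_div_fact j * sinhc_coef (n - j) = (- 2^-1) ^+ n / n`!%:R.
Proof.
have prod := power_series_near0_mul bernoulli_div_fact_gf sinhc_gf.
apply: (power_series_near0_inj prod (b := fun n => (- 2^-1) ^+ n / n`!%:R)).
apply: filterS (nbhs_dnbhs_neq (0 : R)) => t t0.
suff -> : t / (expR t - 1) * ((expR (2^-1 * t) - expR (- 2^-1 * t)) / t)
   = expR (- 2^-1 * t) by exact: expR_series.
have e1 : expR t - 1 != 0.
  by rewrite subr_eq0 -expR0; apply: contra t0 => /eqP/expR_inj ->.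
have et : expR t = expR (2^-1 * t) ^+ 2.
  by rewrite -expRM_natl; congr expR; lra.
have xy : expR (2^-1 * t) * expR (- 2^-1 * t) = 1.
  by rewrite mulNr expRxMexpNx_1.
move: e1; rewrite et; move: (expR (2^-1 * t)) (expR (- 2^-1 * t)) xy => x y xy e1.
have -> : t / (x ^+ 2 - 1) * ((x - y) / t) = (x - y) / (x ^+ 2 - 1).
  by field; rewrite t0 e1.
apply: (mulIf e1); rewrite divfK// mulrBr mulr1 expr2 mulrA [y * x]mulrC xy.
by rewrite mul1r.
Qed.

Definition sinhc_even (m : nat) : R := (2 ^+ (2 * m) * ((2 * m).+1)`!%:R)^-1.

Lemma sinhc_coef_even m : sinhc_coef (2 * m) = sinhc_even m.
Proof.
rewrite /sinhc_coef /sinhc_even exprNn -signr_odd /= oddM /= expr1 mulN1r opprK.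
rewrite invfM -exprVn exprS.
have -> : 2^-1 * 2^-1 ^+ (2 * m) + 2^-1 * 2^-1 ^+ (2 * m) = 2^-1 ^+ (2 * m) :> R by lra.
by [].
Qed.

Lemma sinhc_coef_odd m : odd m -> sinhc_coef m = 0.
Proof.
by move=> om; rewrite /sinhc_coef exprNn -signr_odd /= om /= expr0 mul1r subrr mul0r.
Qed.

Lemma sum_even (G : nat -> R) m :
  (forall j, (j < 2 * m)%N -> odd j -> G j = 0) ->
  \sum_(j < (2 * m).+1) G j = \sum_(i < m.+1) G (2 * i)%N.
Proof.
elim: m => [|m IH] G0; first by rewrite muln0 !big_ord1 muln0.
have -> : (2 * m.+1 = (2 * m).+2)%N by lia.
rewrite [LHS]big_ord_recr/= [X in X + _ = _]big_ord_recr/= IH => [|j jm]; last by apply: G0; lia.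
rewrite (G0 (2 * m).+1) ?addr0 /= ?oddM//; last by lia.
by rewrite [RHS]big_ord_recr/=; congr (_ + G _); lia.
Qed.

(** In degree 2n+2 only even indices contribute. The right-hand side of
    [bernoulli_sinhc_conv] is (2n+3) h_(n+1), and the term B_0 h_(n+1) is moved to
    that side. *)
Lemma bernoulli_sinhc_rec n :
  n.+1%:R * sinhc_even n.+1
  = \sum_(i < n.+1) bernoulli_div_fact (2 * i.+1) / 2 * sinhc_even (n - i).
Proof.
have conv m : \sum_(i < m.+1) bernoulli_div_fact (2 * i) * sinhc_even (m - i)
    = 2^-1 ^+ (2 * m) / (2 * m)`!%:R.
  have := bernoulli_sinhc_conv (2 * m); rewrite exprNn -signr_odd oddM /= expr0 mul1r.
  move=> <-; rewrite (@sum_even (fun j => bernoulli_div_fact j * sinhc_coef (2 * m - j))).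
    by apply: eq_bigr => i _; rewrite -mulnBr sinhc_coef_even.
  by move=> j jm oj; rewrite sinhc_coef_odd ?mulr0// oddB ?oddM ?oj// ltnW.
have b0 : bernoulli_div_fact 0 = 1.
  have := conv 0%N; rewrite big_ord1 muln0 subn0 /sinhc_even muln0.
  by rewrite !expr0 !mul1r !invr1 !mulr1.
have := conv n.+1; rewrite big_ord_recl muln0 b0 mul1r subn0.
under eq_bigr => i _ do rewrite lift0 subSS.
have -> : 2^-1 ^+ (2 * n.+1) / (2 * n.+1)`!%:R
    = (2 * n.+1).+1%:R * sinhc_even n.+1 :> R.
  have K0 : (2 * n.+1).+1%:R != 0 :> R by rewrite pnatr_eq0.
  by rewrite /sinhc_even factS natrM exprVn !invfM [RHS]mulrCA mulVKf.
move=> E; under eq_bigr => i _ do rewrite mulrAC.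
rewrite -mulr_suml.
have -> : \sum_(i < n.+1) bernoulli_div_fact (2 * i.+1) * sinhc_even (n - i)
  = ((2 * n.+1).+1%:R - 1) * sinhc_even n.+1.
  by rewrite mulrBl mul1r -E addrAC subrr add0r.
rewrite -[(2 * n.+1).+1%:R]natr1 addrK natrM.
by rewrite -[2%:R * _ * _]mulrA [2%:R * _]mulrC mulfK.
Qed.

Lemma bernoulli_partition_sum m :
  exp_coef (fun i => bernoulli R (2 * i.+1)
                / ((2 * i.+1)%:R * ((2 * i.+1)`!)%:R)) m = sinhc_even m.
Proof.
symmetry; apply: exp_coef_unique.
  by rewrite /sinhc_even muln0 expr0 mul1r invr1.
move=> n _; rewrite bernoulli_sinhc_rec; apply: eq_bigr => i _; congr (_ * _).
rewrite /bernoulli_div_fact; set b := bernoulli R _.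
rewrite natrM.
have f0 : ((2 * i.+1)`!)%:R != 0 :> R by rewrite pnatr_eq0 -lt0n fact_gt0.
have i0 : i.+1%:R != 0 :> R by rewrite pnatr_eq0.
move: (_`!%:R) f0 (i.+1%:R) i0 => f f0 j j0.
by field; rewrite f0 j0.
Qed.

End Bernoulli.

(** * The identities *)

Theorem theorem5p3 (R : realType) (m : nat) :
  [/\ \esum_(N in [set N : m.-tuple nat |
                    (forall i : 'I_m, (1 <= tnth N i)%N) /\
                    (forall i j : 'I_m, (i < j)%N -> (tnth N i < tnth N j)%N)])
        ((\prod_(i < m) (tnth N i)%:R ^+ 2)^-1 : R)%:E
      = ((-1) ^+ m *
         \sum_(y in partitions m) \prod_(i < m)
           ((-1) ^+ y i / ((y i)`!%:R * i.+1%:R ^+ y i)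
              * zeta (2 * i.+1)%:R ^+ y i))%:E,
      (-1) ^+ m *
      \sum_(y in partitions m) \prod_(i < m)
        ((-1) ^+ y i / ((y i)`!%:R * i.+1%:R ^+ y i)
           * zeta (2 * i.+1)%:R ^+ y i)
      = (pi : R) ^+ (2 * m) / ((2 * m).+1)`!%:R
    & \sum_(y in partitions m) \prod_(i < m)
        (((y i)`!%:R)^-1
           * (bernoulli R (2 * i.+1)
                / ((2 * i.+1)%:R * ((2 * i.+1)`!)%:R)) ^+ y i)
      = (2 ^+ (2 * m) * ((2 * m).+1)`!%:R)^-1].
Proof.
have zetaE : \sum_(y in partitions m) \prod_(i < m)
    ((-1) ^+ y i / ((y i)`!%:R * i.+1%:R ^+ y i) * zeta (2 * i.+1)%:R ^+ y i)
    = zeta_coef R m.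
  apply: eq_bigr => y _; apply: eq_bigr => i _.
  rewrite /= -[- zeta _]mulN1r [in RHS]exprMn [in RHS]exprMn exprVn invfM.
  by rewrite [_^-1 * (_ ^+ _)^-1]mulrC !mulrA [LHS]mulrAC [X in X / _ = _]mulrAC.
rewrite zetaE; split; last 2 first.
- by rewrite zeta_coefE signrMK.
- rewrite -[RHS]/(sinhc_even R m) -bernoulli_partition_sum.
  by apply: eq_bigr => y _; apply: eq_bigr => i _; rewrite mulrC.
have lim : (fun n => (-1) ^+ m * (\prod_(k < n) (1 - inv_sq R k *: 'X))`_m) @ \oo
    --> (-1) ^+ m * zeta_coef R m.
  by apply: cvgMl_tmp; exact: cvg_coef_inv_sq.
rewrite -(esum_increasing (@inv_sq_ge0 R) lim).
apply: eq_esum => N [pos _]; rewrite -prodfV; congr (_%:E).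
by apply: eq_bigr => i _; rewrite /inv_sq prednK ?pos.
Qed.
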